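(* Let $v\ge2$, $\epsilon>0$, $n\ge1$. Let $(Q,\hat P_n)$ be a block design scheme with parameters $(v,b,r,k,\lambda,\epsilon)$ where $k\in K_{opt}(v,\epsilon)$, and let $(Q',\hat P_n')$ be any unbiased scheme whose mechanism $Q'$ is $\epsilon$-LDP. Then $$R^*_{v,n}(\ell_2^2,Q,\hat P_n)\le R^*_{v,n}(\ell_2^2,Q',\hat P_n').$$
   Context: $\mathcal{X}=\{1,\dots,v\}$, $\Delta_v$ the probability vectors on $\mathcal{X}$. A scheme is a pair $(Q,\hat P_n)$ of a conditional distribution $Q$ from $\mathcal{X}$ to an output set $\mathcal{Y}$ and an estimator $\hat P_n:\mathcal{Y}^n\to\mathbb{R}^v$; with $X_1,\dots,X_n$ i.i.d. $\sim P$ and $Y_i\sim Q(\cdot|X_i)$ independently, it is unbiased if $\mathbb{E}[\hat P_n(Y_1,\dots,Y_n)]=P$ for all $P\in\Delta_v$. $Q$ is $\epsilon$-LDP if $Q(A|x)\le e^\epsilon Q(A|x')$ for all $x,x'$ and measurable $A$. $R^*_{v,n}(\ell,Q,\hat P_n)=\sup_{P\in\Delta_v}\mathbb{E}[\ell(P,\hat P_n(Y_1,\dots,Y_n))]$, $\ell_2^2(p,\hat p)=\sum_x(p_x-\hat p_x)^2$. $K_{opt}(v,\epsilon)$ is the set of $k\in\{1,\dots,v-1\}$ minimizing $\frac{(ke^\epsilon+v-k)^2}{k(v-k)}$. For $\mathcal{I}\subset\mathcal{X}\times\mathcal{Y}$, $\mathcal{I}_x=\{y:(x,y)\in\mathcal{I}\}$,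 $\mathcal{I}^y=\{x:(x,y)\in\mathcal{I}\}$; for integers $v>k>0$, $b>r>\lambda\ge0$, a $(v,b,r,k,\lambda)$-block design has $|\mathcal{Y}|=b$, $|\mathcal{I}_x|=r$, $|\mathcal{I}^y|=k$, $|\mathcal{I}_x\cap\mathcal{I}_{x'}|=\lambda$ ($x\neq x'$). A block design scheme with parameters $(v,b,r,k,\lambda,\epsilon)$ uses such a design, $Q(y|x)=\alpha e^\epsilon$ if $(x,y)\in\mathcal{I}$ and $\alpha$ otherwise with $\alpha=1/(re^\epsilon+b-r)$, and $\hat P_{n,x}=\frac{1}{(r-\lambda)(e^\epsilon-1)}\left(\frac{N_x}{n\alpha}-(\lambda e^\epsilon+r-\lambda)\right)$, $N_x=\sum_{i=1}^n\mathbb{1}(Y_i\in\mathcal{I}_x)$. *)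

(* Defs.v *)
From HB Require Import structures.
From mathcomp Require Import all_boot all_order all_algebra.
From mathcomp Require Import all_classical all_reals all_analysis.
Unset Printing Implicit Defensive.
Import Order.TTheory GRing.Theory Num.Theory.
Local Open Scope ring_scope.
Local Open Scope classical_set_scope.

(* Input alphabet X = {1,...,v} is represented by 'I_v.
   Output alphabet of a block design scheme: a finite set with b elements,
   represented by 'I_(b.-1).+1 (which has exactly b elements as soon as
   b >= 1, which holds for every block design since b > r > lambda >= 0);
   it carries the discrete sigma-algebra. *)
Definition bout (b : nat) : Type := 'I_(b.-1).+1.
HB.instance Definition _ b := Finite.on (bout b).
HB.instance Definition _ b := isPointed.Build (bout b) ord0.
HB.instance Definition _ b := @isMeasurable.Build default_measure_display
  (bout b) discrete_measurable discrete_measurable0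
  discrete_measurableC discrete_measurableU.

Section defs.
Context {R : realType}.

Definition prob_simplex (v : nat) : set ('I_v -> R) :=
  [set P | (forall x, 0 <= P x) /\ \sum_(x < v) P x = 1].

(* integral w.r.t. the law of one privatized sample Y_i, i.e. the mixture
   sum_x P_x Q(.|x)  (X_i ~ P, Y_i ~ Q(.|X_i)) *)
Definition mixint {v : nat} {d} {Y : measurableType d}
  (P : 'I_v -> R) (Q : 'I_v -> probability Y R) (g : Y -> \bar R) : \bar R :=
  (\sum_(x < v) (P x)%:E * \int[Q x]_y g y)%E.

(* E[f(Y_1,...,Y_n)] for Y_1,...,Y_n i.i.d. with the law above,
   written as an iterated integral *)
Fixpoint expect {v : nat} {d} {Y : measurableType d}
  (P : 'I_v -> R) (Q : 'I_v -> probability Y R) {n : nat}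
  : (n.-tuple Y -> \bar R) -> \bar R :=
  match n with
  | 0 => fun f => f [tuple]
  | n'.+1 => fun f =>
      mixint P Q (fun y => expect P Q (fun t => f [tuple of y :: t]))
  end.

Definition l2sq {v : nat} (p phat : 'I_v -> R) : R :=
  \sum_(x < v) (p x - phat x) ^+ 2.

Definition risk {v : nat} {d} {Y : measurableType d} {n : nat}
  (Q : 'I_v -> probability Y R) (est : n.-tuple Y -> 'I_v -> R) : \bar R :=
  ereal_sup [set expect P Q (fun t => (l2sq P (est t))%:E)
            | P in prob_simplex v].

Definition unbiased {v : nat} {d} {Y : measurableType d} {n : nat}
  (Q : 'I_v -> probability Y R) (est : n.-tuple Y -> 'I_v -> R) : Prop :=
  (forall x, measurable_fun [set: n.-tuple Y] (fun t => est t x)) /\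
  forall P, prob_simplex v P -> forall x,
    (expect P Q (fun t => `|est t x|%:E) < +oo)%E /\
    expect P Q (fun t => (est t x)%:E) = (P x)%:E.

Definition ldp {v : nat} {d} {Y : measurableType d} (eps : R)
  (Q : 'I_v -> probability Y R) : Prop :=
  forall x x' (A : set Y), measurable A -> (Q x A <= (expR eps)%:E * Q x' A)%E.

Definition kopt_obj (v : nat) (eps : R) (k : nat) : R :=
  (k%:R * expR eps + v%:R - k%:R) ^+ 2 / (k%:R * (v%:R - k%:R)).

Definition Kopt (v : nat) (eps : R) (k : nat) : Prop :=
  (0 < k < v)%N /\
  forall k', (0 < k' < v)%N -> kopt_obj v eps k <= kopt_obj v eps k'.

Definition block_design (v b r k lam : nat) (I : {set 'I_v * bout b}) : Prop :=
  [/\ (0 < k < v)%N, (lam < r < b)%N,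
      forall x : 'I_v, #|[set y | (x, y) \in I]| = r,
      forall y : bout b, #|[set x | (x, y) \in I]| = k &
      forall x x' : 'I_v, x != x' ->
        #|[set y | ((x, y) \in I) && ((x', y) \in I)]| = lam].

Definition bd_alpha (b r : nat) (eps : R) : R :=
  (r%:R * expR eps + b%:R - r%:R)^-1.

Definition bd_prob (v b r : nat) (eps : R) (I : {set 'I_v * bout b})
  (x : 'I_v) (y : bout b) : R :=
  if (x, y) \in I then bd_alpha b r eps * expR eps else bd_alpha b r eps.

Definition bd_count (v b n : nat) (I : {set 'I_v * bout b})
  (t : n.-tuple (bout b)) (x : 'I_v) : nat :=
  count (fun y => (x, y) \in I) t.

Definition bd_est (v b r lam : nat) (eps : R) (I : {set 'I_v * bout b})
  (n : nat) (t : n.-tuple (bout b)) (x : 'I_v) : R :=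
  ((r%:R - lam%:R) * (expR eps - 1))^-1 *
  ((bd_count v b n I t x)%:R / (n%:R * bd_alpha b r eps)
   - (lam%:R * expR eps + r%:R - lam%:R)).

Definition block_design_scheme (v b r k lam : nat) (eps : R) (n : nat)
  (Q : 'I_v -> probability (bout b) R)
  (est : n.-tuple (bout b) -> 'I_v -> R) : Prop :=
  exists I : {set 'I_v * bout b},
    [/\ block_design v b r k lam I,
        forall x y, Q x [set y] = (bd_prob v b r eps I x y)%:E &
        est = bd_est v b r lam eps I n].

End defs.

(* Main.v *)
Require Import Defs.
From HB Require Import structures.
From mathcomp Require Import all_boot all_order all_algebra.
From mathcomp Require Import all_classical all_reals all_analysis.
From mathcomp Require Import ring lra measurable_realfun.
Import Order.TTheory GRing.Theory Num.Theory.
Local Open Scope ring_scope.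

Set Implicit Arguments.
Unset Strict Implicit.
Unset Printing Implicit Defensive.

(** Both risks are compared with K = (v-1)^2 obj(k) / (n v (e^eps-1)^2), where
    obj is the function minimised by K_opt.

    The risk of the block design scheme at P is an explicit constant times
    k - sum_x Pr(Y in I_x)^2.  As sum_x Pr(Y in I_x) = k, Cauchy-Schwarz bounds
    this by k - k^2/v, which turns the constant into K.

    For an arbitrary unbiased scheme, a Chapman-Robbins (finite difference
    Cramer-Rao) argument at the uniform distribution u is used.  Let M be the
    output law under u and q_x = dQ'_x/dM.  Comparing u with the tilts
    (1-t) u + t delta_x, whose n-sample likelihood ratios are
    prod_i (1 + t (q_x(y_i) - 1)), and letting t tend to 0 gives
    risk >= (v-1)^2 / (n S) whenever sum_x (q_x - 1)^2 <= S.  Privacy says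
    q_x <= e^eps q_x' and mixing says sum_x q_x = v.  After
    rescaling q to the cube [0,1]^v the claim becomes an inequality whose defect
    is convex in each coordinate, so only vertices matter: there q has two
    values of ratio e^eps, and with j large coordinates sum_x (q_x - 1)^2 equals
    v (e^eps-1)^2 / obj(j).  Hence S = v (e^eps-1)^2 / obj(k) is admissible. *)

(** * The extremal problem behind privacy *)

Section cube.
Context {R : realType} {v : nat}.
Implicit Types (t : 'I_v -> R) (x : 'I_v).

Definition upd t x s : 'I_v -> R := fun y => if y == x then s else t y.

Lemma sum_upd (g : R -> R) t x s :
  \sum_y g (upd t x s y) = g s + \sum_(y | y != x) g (t y).
Proof.
rewrite (bigD1 x)//= /upd eqxx; congr (_ + _).
by apply: eq_bigr => y /negPf ->.
Qed.

(** Pushing one fractional coordinate to 0 and to 1 bounds [F t] by a convex combination of two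
    values with fewer fractional coordinates. Induction on the number of coordinates outside {0,1}
    ends at the vertices, the indicators of sets. *)
Lemma cube_le0 (F : ('I_v -> R) -> R) :
  (forall t x, 0 <= t x <= 1 ->
    F t <= (1 - t x) * F (upd t x 0) + t x * F (upd t x 1)) ->
  (forall A : {set 'I_v}, F (fun x => (x \in A)%:R) <= 0) ->
  forall t, (forall x, 0 <= t x <= 1) -> F t <= 0.
Proof.
move=> Fconv Fvert t; pose frac t := [set x | t x \notin [:: 0; 1]].
move: {2}(#|_|) (leqnn #|frac t|) => m.
elim: m t => [|m ih] t tm t01; have [frac0|[x xt]] := set_0Vmem (frac t).
- rewrite (_ : t = fun x => (x \in [set x | t x == 1])%:R)//.
  apply/funext => x; rewrite inE; move/setP/(_ x): frac0; rewrite !inE.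
  by move=> /negbFE/orP[]/eqP ->; rewrite ?eqxx// eq_sym oner_eq0.
- by move: tm; rewrite leqn0 cards_eq0 => /eqP E; rewrite E inE in xt.
- by apply: ih => //; rewrite frac0 cards0.
- have fupd s : s \in [:: 0; 1] -> F (upd t x s) <= 0.
    move=> s01; apply: ih.
      rewrite -ltnS (leq_trans _ tm)//; apply: proper_card.
      apply/properP; split.
        apply/fintype.subsetP => y; rewrite !inE /upd; case: (eqVneq y x) => // _.
        by move: s01; rewrite !inE => ->.
      by exists x => //; rewrite inE /upd eqxx s01.
    move=> y; rewrite /upd; case: ifP => // _.
    by move: s01; rewrite !inE => /orP[]/eqP ->; rewrite ?lexx ?ler01.
  apply: (le_trans (Fconv t x (t01 x))).
  have /andP[tx0 tx1] := t01 x.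
  rewrite -[leRHS]addr0 lerD// ?mulr_ge0_le0 ?subr_ge0 ?fupd ?inE ?eqxx ?orbT//.
Qed.

(** The difference of the two sides is quadratic in each coordinate with leading coefficient v - 1 -
    c e^2, so the third hypothesis is coordinatewise convexity. At a vertex with j ones both sums
    equal j, and the last hypothesis concludes. *)
Lemma cube_variance_le (c e : R) : 0 <= c -> 0 <= e -> c * e ^+ 2 <= v%:R - 1 ->
  (forall j, (j <= v)%N ->
    j%:R * (v%:R - j%:R) <= c * (v%:R + e * j%:R) ^+ 2) ->
  forall t, (forall x, 0 <= t x <= 1) ->
  v%:R * (\sum_x t x ^+ 2) - (\sum_x t x) ^+ 2
    <= c * (v%:R + e * \sum_x t x) ^+ 2.
Proof.
move=> c0 e0 ce cj t t01; rewrite -subr_le0.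
pose F (t : 'I_v -> R) := v%:R * (\sum_x t x ^+ 2) - (\sum_x t x) ^+ 2
  - c * (v%:R + e * \sum_x t x) ^+ 2.
apply: (@cube_le0 F) t01 => {t} [t x /andP[t0 t1]|A].
  rewrite -{1}(_ : upd t x (t x) = t); last first.
    by apply/funext => y; rewrite /upd; case: eqP => // ->.
  rewrite /F !(sum_upd (fun s => s ^+ 2)) !(sum_upd id) -subr_ge0.
  set S1 := \sum_(_ | _) _; set S2 := \sum_(_ | _) _.
  (* For a quadratic on [0,1], chord minus function is the leading coefficient times s (1 - s). *)
  rewrite (_ : _ - _ = (v%:R - 1 - c * e ^+ 2) * (t x * (1 - t x))); last ring.
  by rewrite !mulr_ge0// ?subr_ge0.
rewrite /F.
have -> : \sum_x (x \in A)%:R ^+ 2 = #|A|%:R :> R.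
  rewrite -sum1_card natr_sum [RHS]big_mkcond/=.
  by apply: eq_bigr => x _; case: (x \in A); rewrite ?expr1n ?expr0n.
have -> : \sum_x (x \in A)%:R = #|A|%:R :> R.
  by rewrite -sum1_card natr_sum [RHS]big_mkcond/=; apply: eq_bigr => x _; case: ifP.
rewrite subr_le0 (le_trans _ (cj #|A| _))//; last by rewrite -[leqRHS]card_ord max_card.
by rewrite (_ : _ - _ = #|A|%:R * (v%:R - #|A|%:R))//; ring.
Qed.

(** With m the least value of q, write q x = m (1 + (E - 1) t x), where t lies in the cube. Since
    sum q = v, multiplying both sides by v makes them homogeneous in m: each becomes m^2 (E - 1)^2
    times the matching side of [cube_variance_le]. *)
Lemma cone_variance_le (c E : R) (q : 'I_v -> R) :
  0 <= c -> 1 < E -> (0 < v)%N -> c * (E - 1) ^+ 2 <= v%:R - 1 ->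
  (forall j, (j <= v)%N ->
    j%:R * (v%:R - j%:R) <= c * (v%:R + (E - 1) * j%:R) ^+ 2) ->
  (forall x x', q x <= E * q x') -> \sum_x q x = v%:R ->
  \sum_x (q x - 1) ^+ 2 <= c * (E - 1) ^+ 2 * v%:R.
Proof.
move=> c0 E1 v0 cE cj qE qv.
pose x0 : 'I_v := Ordinal v0.
pose m := q [arg min_(x < x0) q x]%O.
have mq x : m <= q x by rewrite /m; case: arg_minP => // i _; apply.
have E0 : 0 < E - 1 by rewrite subr_gt0.
have vR : 0 < v%:R :> R by rewrite ltr0n.
have m0 : 0 < m.
  (* If m <= 0, then every q x <= E m <= 0, which contradicts the positive sum v. *)
  rewrite ltNge; apply/negP => m0; move: vR; rewrite -qv ltNge => /negP; apply.
  apply: sumr_le0 => x _; apply: (le_trans (qE x [arg min_(x < x0) q x]%O)).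
  by rewrite -/m mulr_ge0_le0// ltW// (lt_trans ltr01).
pose t x := (q x / m - 1) / (E - 1).
have qt x : q x = m * (1 + (E - 1) * t x).
  by rewrite /t; field; rewrite !gt_eqF.
have t01 x : 0 <= t x <= 1.
  apply/andP; split.
    apply: divr_ge0; last exact: ltW.
    by rewrite subr_ge0 ler_pdivlMr// mul1r.
  by rewrite ler_pdivrMr// mul1r lerD2r ler_pdivrMr// qE.
have := cube_variance_le c0 (ltW E0) cE cj t01.
set T := \sum_x t x; set S := \sum_x t x ^+ 2 => TS.
have qT : m * (v%:R + (E - 1) * T) = v%:R.
  rewrite -{2}qv; under [RHS]eq_bigr do rewrite qt mulrDr mulr1.
  rewrite big_split/= sumr_const card_ord -mulr_sumr -mulr_sumr -/T.
  by rewrite mulrDr mulr_natr.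
have q2 : \sum_x (q x - 1) ^+ 2 =
    m ^+ 2 * (v%:R + (E - 1) * T *+ 2 + (E - 1) ^+ 2 * S) - v%:R.
  transitivity (\sum_x (m ^+ 2 * (1 + (E - 1) * t x *+ 2
      + (E - 1) ^+ 2 * t x ^+ 2) + (1 - q x *+ 2))).
    by apply: eq_bigr => x _; rewrite {1}qt [in RHS]qt; ring.
  rewrite big_split/= -mulr_sumr !big_split/= sumrN !sumrMnl qv -!mulr_sumr.
  by rewrite sumr_const card_ord -/T -/S; ring.
rewrite -(ler_pM2l vR) q2.
have -> : v%:R * (m ^+ 2 * (v%:R + (E - 1) * T *+ 2 + (E - 1) ^+ 2 * S) - v%:R)
  = m ^+ 2 * (E - 1) ^+ 2 * (v%:R * S - T ^+ 2)
    + (m * (v%:R + (E - 1) * T)) ^+ 2 - v%:R ^+ 2 by ring.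
rewrite qT addrK.
have -> : v%:R * (c * (E - 1) ^+ 2 * v%:R) =
    m ^+ 2 * (E - 1) ^+ 2 * (c * (v%:R + (E - 1) * T) ^+ 2).
  by rewrite -{1 2}qT; ring.
by rewrite ler_wpM2l// mulr_ge0// sqr_ge0.
Qed.

End cube.

(** This is [cone_variance_le] with c = 1 / obj(k): minimality of obj(k) is the vertex condition. *)
Lemma ldp_vector_bound (R : realType) (v k : nat) (eps : R) (q : 'I_v -> R) :
  0 < eps -> Kopt v eps k ->
  (forall x x', q x <= expR eps * q x') -> \sum_x q x = v%:R ->
  \sum_x (q x - 1) ^+ 2 <= (expR eps - 1) ^+ 2 * v%:R / kopt_obj v eps k.
Proof.
move=> eps0 [/andP[k0 kv] kmin] qE qv.
have E1 : 1 < expR eps by rewrite expR_gt1.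
have E0 : 0 < expR eps - 1 by rewrite subr_gt0.
have v0 : (0 < v)%N by exact: leq_trans kv.
have num j : j%:R * expR eps + v%:R - j%:R = v%:R + (expR eps - 1) * j%:R :> R.
  ring.
have numgt0 j : 0 < v%:R + (expR eps - 1) * j%:R :> R.
  by rewrite ltr_pwDl ?ltr0n// mulr_ge0// ltW.
have dengt0 j : (0 < j < v)%N -> 0 < j%:R * (v%:R - j%:R) :> R.
  by case/andP=> j0 jv; rewrite mulr_gt0 ?ltr0n// subr_gt0 ltr_nat.
have obj0 : 0 < kopt_obj v eps k.
  by rewrite /kopt_obj num divr_gt0 ?exprn_gt0// dengt0// k0.
rewrite mulrC mulrA; apply: cone_variance_le => //.
- by rewrite invr_ge0 ltW.
(* The convexity condition reads e^2 k (v - k) <= (v - 1) (v + e k)^2. It goes through e^2 k^2 (v -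
   1), using k^2 (v - 1) - k (v - k) = k v (k - 1). *)
- rewrite mulrC ler_pdivrMr// /kopt_obj num mulrA ler_pdivlMr ?dengt0 ?k0//.
  have kR : 1 <= k%:R :> R by rewrite ler1n.
  have kvR : k%:R + 1 <= v%:R :> R by rewrite natr1 ler_nat.
  set e := expR eps - 1 in E0 *; move: (k%:R) (v%:R) kR kvR => a b a1 ab.
  have h1 : e ^+ 2 * (a * (b - a)) <= e ^+ 2 * (a ^+ 2 * (b - 1)).
    rewrite ler_wpM2l ?sqr_ge0// -subr_ge0.
    rewrite (_ : _ - _ = a * b * (a - 1)); last by ring.
    by rewrite !mulr_ge0//; lra.
  apply: (le_trans h1).
  have -> : e ^+ 2 * (a ^+ 2 * (b - 1)) = (b - 1) * (e * a) ^+ 2 by ring.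
  rewrite ler_wpM2l//; first by lra.
  rewrite lerXn2r// ?nnegrE ?mulr_ge0//; try lra; try nra.
(* The vertices j = 0 and j = v are outside the range of [kmin], but there the left side
   vanishes. *)
- move=> j jv; have [->|j0] := posnP j; first by rewrite mul0r mulr_ge0// ?invr_ge0 ?sqr_ge0// ltW.
  move: jv; rewrite leq_eqVlt => /orP[/eqP ->|jv].
    by rewrite subrr mulr0 mulr_ge0// ?invr_ge0 ?sqr_ge0// ltW.
  rewrite [leRHS]mulrC ler_pdivlMr// -ler_pdivlMl ?dengt0 ?j0//.
  by rewrite [leRHS]mulrC -num kmin// j0.
Qed.

(** * The risk of a block design scheme *)

Section finite_expectation.
Context {R : realType} {Y : finType} (mu : Y -> R).
Implicit Types (n : nat) (a : Y -> R).

Definition mean a : R := \sum_y mu y * a y.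

(** The recursion follows that of [expect], so that [expect_bout] identifies the two by
    induction. *)
Fixpoint fexp n : (n.-tuple Y -> R) -> R :=
  match n with
  | 0 => fun f => f [tuple]
  | n'.+1 => fun f => mean (fun y => fexp (fun t => f [tuple of y :: t]))
  end.

Lemma meanD a a' : mean (fun y => a y + a' y) = mean a + mean a'.
Proof. by rewrite -big_split; apply: eq_bigr => y _; rewrite mulrDr. Qed.

Lemma meanZ c a : mean (fun y => c * a y) = c * mean a.
Proof. by rewrite mulr_sumr; apply: eq_bigr => y _; rewrite mulrCA. Qed.

Lemma fexpD n (f g : n.-tuple Y -> R) :
  fexp (fun t => f t + g t) = fexp f + fexp g.
Proof.
elim: n f g => //= n ih f g; rewrite -meanD; apply: eq_bigr => y _.
by rewrite ih.
Qed.

Lemma fexpZ n c (f : n.-tuple Y -> R) : fexp (fun t => c * f t) = c * fexp f.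
Proof.
elim: n f => //= n ih f; rewrite -meanZ; apply: eq_bigr => y _.
by rewrite ih.
Qed.

Lemma fexp_sum n (I : finType) (f : I -> n.-tuple Y -> R) :
  fexp (fun t => \sum_i f i t) = \sum_i fexp (f i).
Proof.
elim: n f => //= n ih f; rewrite exchange_big/=; apply: eq_bigr => y _.
by rewrite ih -mulr_sumr.
Qed.

Hypothesis mu1 : \sum_y mu y = 1.

Lemma mean_cst c : mean (fun=> c) = c.
Proof. by rewrite /mean -mulr_suml mu1 mul1r. Qed.

Lemma fexp_cst n c : fexp (fun _ : n.-tuple Y => c) = c.
Proof.
elim: n => //= n ih; rewrite -[RHS]mean_cst; apply: eq_bigr => y _.
by rewrite ih.
Qed.

Lemma fexp_centered_sum n a : mean a = 0 ->
  fexp (fun t : n.-tuple Y => \sum_(y <- t) a y) = 0.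
Proof.
move=> a0; elim: n => [|n ih] /=; first by rewrite big_nil.
rewrite -[RHS]a0; apply: eq_bigr => y _; congr (_ * _).
under eq_fun do rewrite big_cons.
by rewrite fexpD fexp_cst ih addr0.
Qed.

(** Variances of independent samples add: when the square is expanded at the head, the cross term
    has mean zero by [fexp_centered_sum]. *)
Lemma fexp_centered_sum_sqr n a : mean a = 0 ->
  fexp (fun t : n.-tuple Y => (\sum_(y <- t) a y) ^+ 2) =
  n%:R * mean (fun y => a y ^+ 2).
Proof.
move=> a0; elim: n => [|n ih] /=; first by rewrite big_nil mul0r expr0n.
rewrite (_ : _ * _ = mean (fun y => a y ^+ 2) + n%:R * mean (fun y => a y ^+ 2));
  last by rewrite mulrSr mulrDl mul1r addrC.
rewrite -[X in _ = _ + X]mean_cst -meanD; apply: eq_bigr => y _; congr (_ * _).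
under eq_fun => t.
  rewrite big_cons (_ : _ ^+ 2 = a y ^+ 2 + (2 * a y * \sum_(y <- t) a y
    + (\sum_(y <- t) a y) ^+ 2)); last by ring.
  over.
by rewrite fexpD fexp_cst fexpD fexpZ (fexp_centered_sum _ a0) mulr0 add0r ih.
Qed.

End finite_expectation.

Section discrete_expect.
Context {R : realType} {v b : nat} (Q : 'I_v -> probability (bout b) R).
Variables (p : 'I_v -> bout b -> R).
Hypothesis Qp : forall x y, Q x [set y]%classic = (p x y)%:E.
Local Open Scope ereal_scope.

Lemma integral_bout x (g : bout b -> R) :
  \int[Q x]_y (g y)%:E = (\sum_y p x y * g y)%:E.
Proof.
transitivity (\int[Q x]_y (\sum_z (g z)%:E * (\1_[set z]%classic y)%:E)).
  apply: eq_integral => y _; rewrite (bigD1 y)//= big1 => [|z zy].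
    by rewrite adde0 indicE mem_set// mule1.
  by rewrite indicE memNset ?mule0//= => yz; rewrite yz eqxx in zy.
have ii z : (Q x).-integrable setT (fun y => (\1_[set z]%classic y)%:E).
  by apply: integrable_indic; rewrite ?setIT//= (le_lt_trans (probability_le1 _ _))// ltry.
rewrite integral_sum//; last by move=> z; exact: integrableZl.
rewrite -sumEFin; apply: eq_bigr => z _.
transitivity ((g z)%:E * Q x [set z]%classic); last by rewrite Qp -EFinM mulrC.
by rewrite integralZl// integral_indic// setIT.
Qed.

Lemma sum_bout_prob x : (\sum_y p x y = 1)%R.
Proof.
have := integral_bout x (fun=> 1%R).
rewrite integral_cst// mul1e [X in X = _](probability_setT (Q x)) => -[->].
by apply: eq_bigr => y _; rewrite mulr1.
Qed.

Variable P : 'I_v -> R.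

Definition mixp y : R := (\sum_x P x * p x y)%R.

Lemma expect_bout n (f : n.-tuple (bout b) -> R) :
  expect P Q (fun t => (f t)%:E) = (fexp mixp f)%:E.
Proof.
elim: n f => //= n ih f.
rewrite /mixint; under eq_bigr do under eq_integral do rewrite ih.
under eq_bigr do rewrite integral_bout -EFinM.
rewrite sumEFin; congr EFin; rewrite /mean /mixp.
under [RHS]eq_bigr do rewrite mulr_suml.
rewrite exchange_big/=; apply: eq_bigr => x _; rewrite mulr_sumr.
by apply: eq_bigr => y _; rewrite mulrA.
Qed.

End discrete_expect.

(** * Counting in block designs and the exact quadratic risk *)

Section block_design_risk.
Context {R : realType} {v b r k lam : nat} (I : {set 'I_v * bout b}).
Hypothesis BD : block_design v b r k lam I.
Local Notation ind x y := (((x, y) \in I)%:R : R).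

(** The cardinals in [block_design] are those of classical sets, hence the passage through
    [in_setE]. *)
Let card_set1 (T : finType) (D : T -> bool) :
  \sum_y (D y)%:R = #|[set y | D y]%classic|%:R :> R.
Proof.
rewrite -sum1_card natr_sum [RHS]big_mkcond/=; apply: eq_bigr => y _.
have -> : (y \in [set y | D y]%classic) = D y by apply/idP/idP; rewrite in_setE.
by case: (D y).
Qed.

Lemma sum_block x : \sum_y ind x y = r%:R.
Proof. by case: BD => _ _ h _ _; rewrite card_set1 h. Qed.

Lemma sum_dual_block y : \sum_x ind x y = k%:R.
Proof. by case: BD => _ _ _ h _; rewrite card_set1 h. Qed.

Lemma sum_blockI x x' : x != x' -> \sum_y ind x y * ind x' y = lam%:R.
Proof.
case: BD => _ _ _ _ h /h <-; rewrite -card_set1; apply: eq_bigr => y _.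
by rewrite -natrM mulnb.
Qed.

Lemma bd_card : b%:R = \sum_(y : bout b) 1 :> R.
Proof.
case: BD => _ /andP[_ rb] _ _ _; rewrite sumr_const card_ord prednK//.
exact: leq_ltn_trans rb.
Qed.

(** Both sides count the incident pairs (x, y), by rows and by columns. *)
Lemma bd_count_flags : v%:R * r%:R = b%:R * k%:R :> R.
Proof.
transitivity (\sum_x \sum_y ind x y).
  under eq_bigr do rewrite sum_block.
  by rewrite sumr_const card_ord mulr_natl.
rewrite exchange_big/=; under eq_bigr do rewrite sum_dual_block.
by rewrite bd_card mulr_suml; apply: eq_bigr => y _; rewrite mul1r.
Qed.

(** Fix x and count the pairs (x', y) with both x and x' incident to y. By columns there are r k; by
    rows, x' = x contributes r and each other x' contributes lambda. *)
Lemma bd_count_pairs : lam%:R * (v%:R - 1) = r%:R * (k%:R - 1) :> R.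
Proof.
have v0 : (0 < v)%N by case: BD => /andP[k0 kv] *; exact: leq_trans kv.
pose x := Ordinal v0.
have : \sum_x' \sum_y ind x y * ind x' y = r%:R * k%:R.
  rewrite exchange_big/= -(sum_block x) mulr_suml; apply: eq_bigr => y _.
  by rewrite -mulr_sumr sum_dual_block.
rewrite (bigD1 x)//= [X in _ + X](eq_bigr (fun=> lam%:R)); last first.
  by move=> x' x'x; rewrite sum_blockI// eq_sym.
rewrite sumr_const cardC1 card_ord -[_ *+ _]mulr_natr -subn1 natrB//.
rewrite (eq_bigr (fun y => ind x y)) ?sum_block; last first.
  by move=> y _; case: (_ \in _); rewrite ?mulr1 ?mulr0.
by move=> h; rewrite [RHS]mulrBr mulr1 -h; ring.
Qed.

Variables (eps : R) (Q : 'I_v -> probability (bout b) R).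
Hypothesis eps0 : 0 < eps.
Hypothesis Qp : forall x y, Q x [set y]%classic = (bd_prob v b r eps I x y)%:E.

Let e : R := expR eps - 1.
Let al : R := bd_alpha b r eps.
Let w : R := r%:R - lam%:R.

Let e_gt0 : 0 < e. Proof. by rewrite subr_gt0 expR_gt1. Qed.

Let w_gt0 : 0 < w.
Proof. by case: BD => _ /andP[lr _] _ _ _; rewrite subr_gt0 ltr_nat. Qed.

Let alE : al = (r%:R * e + b%:R)^-1.
Proof. by rewrite /al /bd_alpha /e; congr (_^-1); ring. Qed.

Let al_gt0 : 0 < al.
Proof.
case: BD => _ /andP[_ rb] _ _ _.
rewrite alE invr_gt0 ltr_wpDl ?mulr_ge0 ?(ltW e_gt0)// ltr0n.
exact: leq_ltn_trans rb.
Qed.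

Let bd_probE x y : bd_prob v b r eps I x y = al * (1 + e * ind x y).
Proof. by rewrite /bd_prob -/al /e; case: (_ \in _) => /=; ring. Qed.

Section at_P.
Variable P : 'I_v -> R.
Hypothesis P1 : \sum_x P x = 1.

Let mu := mixp (bd_prob v b r eps I) P.
(** The probability that Y lies in I_x when the input law is P (see [mean_ind]); it is affine in P x
    with slope [al * e * w]. *)
Let m x := al * (r%:R + lam%:R * e + P x * e * w).

Let mu1 : \sum_y mu y = 1.
Proof.
rewrite exchange_big/= -P1; apply: eq_bigr => x _.
by rewrite -mulr_sumr (sum_bout_prob Qp) mulr1.
Qed.

Let mean_ind x : mean mu (fun y => ind x y) = m x.
Proof.
rewrite /mean /mu /mixp; under eq_bigr do rewrite mulr_suml.
rewrite exchange_big/= (bigD1 x)//=.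
have E x' : \sum_y P x' * bd_prob v b r eps I x' y * ind x y =
    P x' * al * (r%:R + e * \sum_y ind x y * ind x' y).
  rewrite -(sum_block x) mulr_sumr -big_split/= mulr_sumr.
  by apply: eq_bigr => y _; rewrite bd_probE; ring.
rewrite E [X in _ + X](eq_bigr (fun x' => P x' * (al * (r%:R + e * lam%:R)))); last first.
  by move=> x' x'x; rewrite E sum_blockI 1?eq_sym// mulrA.
rewrite -mulr_suml.
have -> : \sum_(i | i != x) P i = 1 - P x.
  by apply/eqP; rewrite eq_sym subr_eq -P1 (bigD1 x)//= addrC.
rewrite (eq_bigr (fun y => ind x y)) ?sum_block; last first.
  by move=> y _; case: (_ \in _); rewrite ?mulr1 ?mulr0.
by rewrite /m /w; ring.
Qed.

(** The contribution of one sample to the error at x: the centred indicator divided by the slope of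
    [m]. By [bd_estE] the error is the average of these. *)
Let a x y := (w * e * al)^-1 * (ind x y - m x).

Let mean_a x : mean mu (a x) = 0.
Proof. by rewrite meanZ meanD mean_ind mean_cst// subrr mulr0. Qed.

Let mean_a2 x : mean mu (fun y => a x y ^+ 2) = (w * e * al) ^- 2 * (m x - m x ^+ 2).
Proof.
transitivity (mean mu (fun y => (w * e * al) ^- 2 *
    ((1 - m x *+ 2) * ind x y + m x ^+ 2))).
  apply: eq_bigr => y _; congr (_ * _); rewrite /a exprMn exprVn.
  by congr (_ * _); case: (_ \in _) => /=; ring.
by rewrite meanZ meanD meanZ mean_ind mean_cst//; congr (_ * _); ring.
Qed.

Lemma bd_estE n (t : n.-tuple (bout b)) x : (0 < n)%N ->
  bd_est v b r lam eps I n t x - P x = n%:R^-1 * \sum_(y <- t) a x y.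
Proof.
move=> n0; have nR : n%:R != 0 :> R by rewrite pnatr_eq0 -lt0n.
rewrite /bd_est /bd_count -mulr_sumr sumrB.
have -> : \sum_(y <- t) m x = n%:R * m x.
  by rewrite big_const_seq count_predT size_tuple iter_addr_0 mulr_natl.
have -> : \sum_(y <- t) ind x y = (count (fun y => (x, y) \in I) t)%:R.
  by rewrite -sum1_count natr_sum [RHS]big_mkcond/=; apply: eq_bigr => y _; case: ifP.
rewrite -/w -/e -/al /m; move: (count _ _)%:R => c.
have -> : expR eps = e + 1 by rewrite /e subrK.
rewrite /w; field.
by rewrite -/w nR !gt_eqF.
Qed.

Lemma sum_m : \sum_x m x = k%:R.
Proof.
under eq_bigr do rewrite -mean_ind /mean.
transitivity (\sum_y mu y * k%:R); last by rewrite -mulr_suml mu1 mul1r.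
rewrite exchange_big/=; apply: eq_bigr => y _.
by rewrite -mulr_sumr sum_dual_block.
Qed.

(** Each coordinate contributes a rescaled Bernoulli variance m x - (m x)^2, divided by n; the
    linear terms add up to k by [sum_m]. *)
Lemma fexp_bd_est n : (0 < n)%N ->
  fexp mu (fun t => l2sq P (bd_est v b r lam eps I n t)) =
  n%:R^-1 * (w * e * al) ^- 2 * (k%:R - \sum_x m x ^+ 2).
Proof.
move=> n0; rewrite /l2sq fexp_sum -sum_m -sumrB mulr_sumr; apply: eq_bigr => x _.
transitivity (fexp mu (fun t : n.-tuple _ =>
    (n%:R ^- 2) * (\sum_(y <- t) a x y) ^+ 2)).
  by congr fexp; apply/funext => t; rewrite -sqrrN opprB bd_estE// exprMn exprVn.
rewrite fexpZ fexp_centered_sum_sqr// mean_a2 !mulrA; congr (_ * _ * _).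
by field; rewrite pnatr_eq0 -lt0n.
Qed.

Lemma sum_m2 : k%:R ^+ 2 / v%:R <= \sum_x m x ^+ 2.
Proof.
have v0 : 0 < v%:R :> R.
  by rewrite ltr0n; case: BD => /andP[k0 kv] *; exact: leq_trans kv.
rewrite -subr_ge0.
have <- : \sum_x (m x - k%:R / v%:R) ^+ 2 = \sum_x m x ^+ 2 - k%:R ^+ 2 / v%:R.
  transitivity (\sum_x (m x ^+ 2 - k%:R / v%:R * 2 * m x + (k%:R / v%:R) ^+ 2)).
    by apply: eq_bigr => x _; ring.
  rewrite big_split sumrB/= -mulr_sumr sum_m sumr_const card_ord -mulr_natr.
  by field; rewrite gt_eqF.
by apply: sumr_ge0 => x _; exact: sqr_ge0.
Qed.

End at_P.

Lemma bd_risk_le n : (0 < n)%N ->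
  (risk Q (bd_est v b r lam eps I n) <=
   ((v%:R - 1) ^+ 2 * kopt_obj v eps k / (n%:R * v%:R * e ^+ 2))%:E)%E.
Proof.
move=> n0; apply: ge_ereal_sup => _ [P [P0 P1] <-].
rewrite (expect_bout Qp) lee_fin fexp_bd_est//.
have kv : (0 < k < v)%N by case: BD.
have [k0 kv'] : 0 < k%:R :> R /\ k%:R < v%:R :> R by rewrite ltr0n ltr_nat; apply/andP.
have v0 : 0 < v%:R :> R := lt_trans k0 kv'.
have v1 : 0 < v%:R - 1 :> R.
  by rewrite subr_gt0 ltr1n; case/andP: kv => ?; exact: leq_ltn_trans.
have nR : 0 < n%:R :> R by rewrite ltr0n.
have r0 : 0 < r%:R :> R.
  by rewrite ltr0n; case: BD => _ /andP[lr _] *; exact: leq_ltn_trans lr.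
(* The two counting identities express b and w through v, k and r; r then cancels from the risk. *)
have bE : b%:R = v%:R * r%:R / k%:R :> R by rewrite bd_count_flags mulfK ?gt_eqF.
have wE : w = r%:R * (v%:R - k%:R) / (v%:R - 1).
  rewrite -[w](mulfK (lt0r_neq0 v1)); congr (_ / _).
  by rewrite /w mulrBl bd_count_pairs; ring.
apply: (@le_trans _ _ (n%:R^-1 * (w * e * al) ^- 2 * (k%:R - k%:R ^+ 2 / v%:R))).
  rewrite ler_wpM2l//; last by rewrite lerD2l lerN2 sum_m2.
  by rewrite mulr_ge0 ?invr_ge0 ?sqr_ge0// ltW.
rewrite le_eqVlt; apply/orP; left; apply/eqP.
rewrite /kopt_obj alE bE wE (_ : expR eps = e + 1); last by rewrite /e subrK.
field.
have kv0 : 0 < v%:R - k%:R :> R by rewrite subr_gt0.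
have d0 : 0 < r%:R * e * k%:R + v%:R * r%:R.
  by rewrite addr_gt0 ?mulr_gt0// e_gt0.
by rewrite !lt0r_neq0// e_gt0.
Qed.

End block_design_risk.

(** * Product measures on tuples and the iterated expectation *)

Section tuple_probability.
Local Open Scope classical_set_scope.
Context {R : realType} {d} {Y : measurableType d}.
Implicit Types (M : probability Y R) (n : nat).
Local Open Scope ereal_scope.

Definition tcons n (z : Y * n.-tuple Y) : n.+1.-tuple Y :=
  [tuple of z.1 :: z.2].

Lemma measurable_tcons n : measurable_fun [set: Y * n.-tuple Y] (@tcons n).
Proof. exact: measurable_cons. Qed.

HB.instance Definition _ n :=
  isMeasurableFun.Build _ _ _ _ (@tcons n) (@measurable_tcons n).

(** The n-fold product measure, built head first to match the order of integration in [expect]. *)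
Fixpoint tprob M n : probability (n.-tuple Y) R :=
  match n with
  | 0 => dirac [tuple]
  | n'.+1 => distribution (M \x tprob M n')%E (@tcons n')
  end.

Lemma measurable_comp_tcons {d' n} {U : measurableType d'}
    (f : n.+1.-tuple Y -> U) (y : Y) :
  measurable_fun setT f ->
  measurable_fun setT (fun t : n.-tuple Y => f [tuple of y :: t]).
Proof.
move=> mf; apply: (measurableT_comp mf).
exact: (@measurable_cons _ _ _ _ (cst y) n id).
Qed.

Lemma integral_tprob0 M (f : 0.-tuple Y -> \bar R) :
  \int[tprob M 0]_t f t = f [tuple].
Proof.
transitivity (\int[tprob M 0]_t (cst (f [tuple]) t)).
  by apply: eq_integral => t _; rewrite tuple0.
by rewrite integral_cst// -[RHS]mule1; congr *%E; exact: (probability_setT (tprob M 0)).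
Qed.

Lemma ge0_integral_tprobS M n (f : n.+1.-tuple Y -> \bar R) :
  measurable_fun setT f -> (forall t, 0 <= f t) ->
  \int[tprob M n.+1]_t f t =
    \int[M]_y \int[tprob M n]_t f [tuple of y :: t].
Proof.
move=> mf f0; rewrite ge0_integral_distribution// fubini_tonelli1//.
  exact: measurableT_comp.
by move=> x; apply: f0.
Qed.

Lemma integrable_tcons M n (f : n.+1.-tuple Y -> \bar R) :
  (tprob M n.+1).-integrable setT f ->
  (M \x tprob M n).-integrable setT (f \o @tcons n).
Proof.
move=> /integrableP[mf fi]; apply/integrableP; split.
  exact: measurableT_comp.
move: fi; rewrite ge0_integral_distribution//.
exact: measurableT_comp.
Qed.

Lemma integral_tprobS M n (f : n.+1.-tuple Y -> \bar R) :
  (tprob M n.+1).-integrable setT f ->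
  \int[tprob M n.+1]_t f t =
    \int[M]_y \int[tprob M n]_t f [tuple of y :: t].
Proof.
move=> fi; have fci := integrable_tcons fi.
rewrite integral_distribution//; last exact: measurable_int fi.
by rewrite -integral12_prod_meas1.
Qed.

Lemma ae_integrable_tcons M n (f : n.+1.-tuple Y -> \bar R) :
  (tprob M n.+1).-integrable setT f ->
  {ae M, forall y,
    (tprob M n).-integrable setT (fun t => f [tuple of y :: t])}.
Proof. by move=> /integrable_tcons/ae_integrable1. Qed.

End tuple_probability.

(** * The law of one privatized sample, and [expect] as an integral over tuples *)

Section mixture.
Local Open Scope classical_set_scope.
Context {R : realType} {v : nat} {d} {Y : measurableType d}.
Variables (P : 'I_v -> R) (Q : 'I_v -> probability Y R).
Hypothesis PS : prob_simplex v P.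
Local Open Scope ereal_scope.

Let P0 x : (0 <= P x)%R. Proof. by case: PS. Qed.

(* msum is indexed by nat, hence the partial embedding of nat into 'I_v. *)
Definition mixture_component (i : nat) : {measure set Y -> \bar R} :=
  if insub i is Some x then mscale (NngNum (P0 x)) (Q x) else mzero.

Definition mixture : set Y -> \bar R := msum mixture_component v.

HB.instance Definition _ := Measure.on mixture.

Lemma mixtureE A : mixture A = \sum_(x < v) (P x)%:E * Q x A.
Proof. by apply: eq_bigr => x _; rewrite /mixture_component valK. Qed.

Lemma ge0_integral_mixture (g : Y -> \bar R) :
  measurable_fun setT g -> (forall y, 0 <= g y) ->
  \int[mixture]_y g y = mixint P Q g.
Proof.
move=> mg g0; rewrite ge0_integral_measure_sum//; apply: eq_bigr => x _.
by rewrite /mixture_component valK ge0_integral_mscale.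
Qed.

Let mixture_setT : mixture setT = 1.
Proof.
have := @ge0_integral_mixture (cst 1) (measurable_cst _) (fun=> lee01).
rewrite integral_cst// mul1e => ->.
transitivity (\sum_(x < v) (P x)%:E); last by rewrite sumEFin; case: PS => _ ->.
apply: eq_bigr => x _; rewrite integral_cst// mul1e -[RHS]mule1; congr *%E.
exact: (probability_setT (Q x)).
Qed.

HB.instance Definition _ := Measure_isProbability.Build _ _ _ mixture mixture_setT.

Lemma integral_mixture (g : Y -> \bar R) :
  mixture.-integrable setT g -> \int[mixture]_y g y = mixint P Q g.
Proof.
move=> gi; have mg := measurable_int _ gi.
rewrite integralE /mixint.
under [RHS]eq_bigr do rewrite integralE.
have mp : measurable_fun setT g^\+ by exact: measurable_funepos.
have mn : measurable_fun setT g^\- by exact: measurable_funeneg.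
have pfin : \int[mixture]_y g^\+ y \is a fin_num.
  exact/integrable_fin_num/integrable_funepos.
have nfin : \int[mixture]_y g^\- y \is a fin_num.
  exact/integrable_fin_num/integrable_funeneg.
move: pfin nfin; rewrite !ge0_integral_mixture//.
move=> /sum_fin_numP pfin /sum_fin_numP nfin.
rewrite -fin_num_sumeN; last by move=> i _; apply: nfin; rewrite ?mem_index_enum.
rewrite -big_split/=; apply: eq_bigr => x _.
have := pfin x (mem_index_enum _) isT; have := nfin x (mem_index_enum _) isT.
(* A component of weight zero may have infinite integrals, which the factor 0 erases. With positive
   weight, finiteness of the product forces finiteness of the integral. *)
have [->|Px0] := eqVneq (P x) 0%R; first by rewrite !mul0e oppe0 adde0.
have aux (a : \bar R) : (P x)%:E * a \is a fin_num -> a \is a fin_num.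
  have Px : (0 < P x)%R by rewrite lt_neqAle eq_sym Px0 P0.
  by case: a => //; rewrite ?gt0_muley ?gt0_muleNy// lte_fin.
by move=> /aux nf /aux pf; rewrite [RHS]muleBr ?fin_num_adde_defl ?fin_numN.
Qed.

(** No sign or integrability is assumed, so Tonelli measurability is applied to the positive and
    negative parts separately. *)
Lemma measurable_mixint {d'} {Z : measurableType d'} (f : Z * Y -> \bar R) :
  measurable_fun setT f ->
  measurable_fun setT (fun z => mixint P Q (fun y => f (z, y))).
Proof.
move=> mf; apply: emeasurable_sum => x; apply: measurable_funeM.
rewrite (_ : (fun z => _) = fubini_F (Q x) f^\+ \- fubini_F (Q x) f^\-); last first.
  apply/funext => z; rewrite integralE.
  under eq_integral do rewrite (funepos_comp f (pair z))/=.
  by under [X in _ - X = _]eq_integral do rewrite (funeneg_comp f (pair z))/=.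
apply: emeasurable_funB; apply: measurable_fun_fubini_tonelli_F => //.
- exact: measurable_funepos.
- exact: measurable_funeneg.
Qed.

End mixture.

Section expectation.
Local Open Scope classical_set_scope.
Context {R : realType} {v : nat} {d} {Y : measurableType d}.
Variables (P : 'I_v -> R) (Q : 'I_v -> probability Y R).
Hypothesis PS : prob_simplex v P.
Local Open Scope ereal_scope.

(** The parameter space Z is there for the induction: the head of the tuple moves into it, and the
    induction hypothesis is used at Z * Y. *)
Lemma measurable_expect {d'} {Z : measurableType d'} n
    (f : Z * n.-tuple Y -> \bar R) :
  measurable_fun setT f ->
  measurable_fun setT (fun z => expect P Q (fun t => f (z, t))).
Proof.
elim: n d' Z f => [|n ih] d' Z f mf /=.
  by apply: (@measurableT_comp _ _ _ _ _ _ f _ (pair^~ [tuple])).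
pose g (zyt : (Z * Y) * n.-tuple Y) : Z * n.+1.-tuple Y :=
  (zyt.1.1, [tuple of zyt.1.2 :: zyt.2]).
have mg : measurable_fun setT g.
  apply: measurable_fun_pair; first exact: (measurableT_comp measurable_fst measurable_fst).
  apply: (@measurable_cons _ _ _ _ (fun zyt : Z * Y * n.-tuple Y => zyt.1.2)
    n (fun zyt => zyt.2)); last exact: measurable_snd.
  exact: (measurableT_comp measurable_snd measurable_fst).
have /(measurable_mixint P Q) := ih _ _ _ (measurableT_comp mf mg).
exact.
Qed.

Lemma measurable_expect_tcons n (f : n.+1.-tuple Y -> \bar R) :
  measurable_fun setT f ->
  measurable_fun setT (fun y => expect P Q (fun t => f [tuple of y :: t])).
Proof.
move=> mf; apply: (measurable_expect (f := fun yt => f (tcons yt))).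
exact: measurableT_comp.
Qed.

Let M : probability Y R := mixture Q PS.

Lemma ge0_expectE n (f : n.-tuple Y -> \bar R) :
  measurable_fun setT f -> (forall t, 0 <= f t) ->
  expect P Q f = \int[tprob M n]_t f t.
Proof.
elim: n f => [|n ih] f mf f0; first by rewrite integral_tprob0.
rewrite ge0_integral_tprobS// ge0_integral_mixture//.
- by rewrite [LHS]/=; congr mixint; apply/funext => y; rewrite ih//; exact: measurable_comp_tcons.
- apply: (measurable_fun_fubini_tonelli_F (f \o @tcons d Y n)) => //.
  exact: measurableT_comp.
  by move=> y; exact: f0.
- by move=> y; apply: integral_ge0 => t _; exact: f0.
Qed.

(** For signed f the inner integrals are matched by induction only at heads whose section is
    integrable, that is, almost everywhere; [measurable_expect_tcons] lets this equality pass under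
    the outer integral. *)
Lemma expectE n (f : n.-tuple Y -> \bar R) :
  (tprob M n).-integrable setT f ->
  expect P Q f = \int[tprob M n]_t f t.
Proof.
elim: n f => [|n ih] f fi; first by rewrite integral_tprob0.
have mf := measurable_int _ fi.
rewrite integral_tprobS// [LHS]/=.
have Fi := integrable_fubini_F (integrable_tcons fi).
have mE := measurable_expect_tcons mf.
have ae : ae_eq M setT (fun y => expect P Q (fun t => f [tuple of y :: t]))
    (fun y => \int[tprob M n]_t f [tuple of y :: t]).
  apply: filterS (ae_integrable_tcons fi) => y fyi _; exact: ih.
rewrite -(integral_mixture (PS := PS)).
  apply: ae_eq_integral => //; exact: measurable_int Fi.
apply/integrableP; split => //; case/integrableP: Fi => mF; apply: le_lt_trans.
rewrite le_eqVlt; apply/orP; left; apply/eqP; apply: ae_eq_integral => //.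
- exact: measurableT_comp.
- exact: measurableT_comp.
- by apply: filterS ae => y /= /[apply] ->.
Qed.

End expectation.

(** * Densities of a private mechanism *)

Lemma uniform_simplex {R : realType} {v : nat} : (0 < v)%N ->
  prob_simplex v (fun=> v%:R^-1 : R).
Proof.
move=> v0; split => [x|]; first by rewrite invr_ge0.
by rewrite sumr_const card_ord -[_ *+ v]mulr_natr mulVf// pnatr_eq0 -lt0n.
Qed.

Section density.
Local Open Scope classical_set_scope.
Context {R : realType} {v : nat} {d} {Y : measurableType d}.
Variables (eps : R) (Q : 'I_v -> probability Y R).
Hypotheses (v0 : (0 < v)%N) (eps0 : 0 < eps) (Qldp : ldp eps Q).
Local Open Scope ereal_scope.

Definition umix : probability Y R := mixture Q (uniform_simplex v0).

Let vR : v%:R != 0%R :> R. Proof. by rewrite pnatr_eq0 -lt0n. Qed.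

Lemma umixE A : v%:R%:E * umix A = \sum_x Q x A.
Proof.
rewrite [umix A]mixtureE ge0_sume_distrr => [|x _]; last by rewrite mule_ge0.
by apply: eq_bigr => x _; rewrite muleA -EFinM divff// mul1e.
Qed.

Lemma dominates_umix x : Q x `<< umix.
Proof.
apply/null_content_dominatesP => A mA MA0; apply/eqP.
rewrite -measure_le0.
have := umixE A; rewrite MA0 mule0 => ->.
by rewrite (bigD1 x)//= leeDl// sume_ge0.
Qed.

(** Radon-Nikodym densities with respect to the uniform mixture. The two constraints are obtained at
    every y because [ldp_vector_bound] is applied pointwise. *)
Lemma ldp_density : exists q : 'I_v -> Y -> R,
  [/\ forall x, measurable_fun setT (q x),
      forall x x' y, (q x y <= expR eps * q x' y)%R,
      forall y, (\sum_x q x y = v%:R)%R &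
      forall x (g : Y -> \bar R), measurable_fun setT g -> (forall y, 0 <= g y) ->
        \int[Q x]_y g y = \int[umix]_y ((q x y)%:E * g y)].
Proof.
pose f x := Radon_Nikodym_SigmaFinite.f (Q x) umix.
have f0 x y : 0 <= f x y := Radon_Nikodym_SigmaFinite.f_ge0 (dominates_umix x) y.
have ffin x y : f x y \is a fin_num :=
  Radon_Nikodym_SigmaFinite.f_fin_num (dominates_umix x) y.
have fi x : umix.-integrable setT (f x) :=
  Radon_Nikodym_SigmaFinite.f_integrable (dominates_umix x).
have mf x : measurable_fun setT (f x) := measurable_int _ (fi x).
have fE x A : measurable A -> \int[umix]_(y in A) f x y = Q x A.
  by move=> mA; rewrite -(Radon_Nikodym_SigmaFinite.f_integral (dominates_umix x)).
have mEf x : measurable_fun setT (fun y => (expR eps)%:E * f x y).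
  exact: measurable_funeM.
(* On the measurable set where the bound fails, privacy forces both sides to
   have the same integrals, hence to agree almost everywhere. *)
have aele : {ae umix, forall y, forall x, forall x', f x y <= (expR eps)%:E * f x' y}.
  apply: filter_forall => x; apply: filter_forall => x'.
  pose B := setT `&` [set y | (expR eps)%:E * f x' y < f x y].
  have mB : measurable B by exact: measurable_lte.
  have : ae_eq umix B (f x) (fun y => (expR eps)%:E * f x' y).
    apply: integral_ae_eq => //.
    - exact: integrableS (fi x).
    - exact: measurable_funTS.
    - move=> A AB mA; apply/eqP; rewrite eq_le; apply/andP; split.
        rewrite ge0_integralZl// ?fE//; last exact: measurable_funTS.
        by rewrite Qldp.
      apply: ge0_le_integral => //.
      + by move=> y _; rewrite mule_ge0.
      + exact: measurable_funTS.
      + exact: measurable_funTS.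
      + by move=> y /AB [_ /ltW].
  apply: filterS => y /= By; rewrite leNgt; apply/negP => lt.
  by have := By (conj I lt) => eq; rewrite /= eq ltxx in lt.
have aesum : {ae umix, forall y, \sum_x f x y = v%:R%:E}.
  have : ae_eq umix setT (fun y => \sum_x f x y) (cst v%:R%:E).
    apply: integral_ae_eq => //.
    - exact: integrable_sum.
    - move=> A _ mA; rewrite integral_cst// umixE.
      rewrite ge0_integral_sum//; first by apply: eq_bigr => x _; rewrite fE.
      by move=> x; exact: measurable_funTS.
  by apply: filterS => y /(_ I).
have [N [mN N0 goodN]] : {ae umix, forall y,
    (forall x x', f x y <= (expR eps)%:E * f x' y) /\ \sum_x f x y = v%:R%:E}.
  exact: filterI aele aesum.
have {}goodN y : ~ N y ->
    (forall x x', f x y <= (expR eps)%:E * f x' y) /\ \sum_x f x y = v%:R%:E.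
  by move=> Ny; apply: contrapT => /goodN.
(* Resetting the densities to 1 on the exceptional null set makes the two
   constraints hold everywhere. *)
pose q x y := (\1_N y + (1 - \1_N y) * fine (f x y))%R.
have qN x y : N y -> q x y = 1%R.
  by move=> Ny; rewrite /q indicE mem_set// subrr mul0r addr0.
have qNN x y : ~ N y -> q x y = fine (f x y).
  by move=> Ny; rewrite /q indicE memNset// subr0 mul1r add0r.
have mq x : measurable_fun setT (q x).
  apply: measurable_funD; first exact: measurable_indic.
  apply: measurable_funM; last exact: measurableT_comp.
  by apply: measurable_funB => //; exact: measurable_indic.
exists q; split => //.
- move=> x x' y; have [Ny|Ny] := pselect (N y).
    by rewrite !qN// mulr1 -expR0 ler_expR ltW.
  by rewrite !qNN// -lee_fin EFinM !fineK//; exact: (goodN y Ny).1.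
- move=> y; have [Ny|Ny] := pselect (N y).
    by rewrite (eq_bigr (fun=> 1%R)) ?sumr_const ?card_ord// => x _; exact: qN.
  under eq_bigr do rewrite qNN//.
  apply: EFin_inj; rewrite -sumEFin -(goodN y Ny).2.
  by apply: eq_bigr => x _; rewrite fineK.
- move=> x g mg g0.
  rewrite -(Radon_Nikodym_SigmaFinite.change_of_variables (dominates_umix x))//.
  apply: ae_eq_integral => //.
  + exact: (emeasurable_funM mg (mf x)).
  + by apply: emeasurable_funM => //; exact/measurable_EFinP.
  + exists N; split => // y /= h; apply: contrapT => Ny; apply: h => _.
    by rewrite qNN// fineK// muleC.
Qed.

End density.

(** * The Chapman-Robbins bound *)

Section tuple_density.
Local Open Scope classical_set_scope.
Context {R : realType} {d} {Y : measurableType d}.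
Implicit Types (M : probability Y R) (n : nat).
Local Open Scope ereal_scope.

Lemma measurable_tuple_prod n (w : Y -> R) : measurable_fun setT w ->
  measurable_fun setT (fun t : n.-tuple Y => \prod_(y <- t) w y)%R.
Proof.
move=> mw; under eq_fun do rewrite big_tuple.
apply: measurable_prod => i _; apply: measurableT_comp => //.
exact: measurable_tnth.
Qed.

Lemma ge0_integral_tprob_prod M n (g : Y -> R) (c : R) :
  measurable_fun setT g -> (forall y, 0 <= g y)%R ->
  \int[M]_y (g y)%:E = c%:E ->
  \int[tprob M n]_t (\prod_(y <- t) g y)%:E = (c ^+ n)%:E.
Proof.
move=> mg g0 gc; elim: n => [|n ih].
  by rewrite integral_tprob0 big_nil expr0.
have prod0 m (t : m.-tuple Y) : (0 <= \prod_(y <- t) g y)%R.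
  by apply: prodr_ge0.
rewrite ge0_integral_tprobS; last by move=> t; rewrite lee_fin.
  transitivity (\int[M]_y ((c ^+ n)%:E * (g y)%:E)).
    apply: eq_integral => y _; rewrite -ih muleC -ge0_integralZl//.
    - by apply: eq_integral => t _; rewrite big_cons EFinM.
    - by apply/measurable_EFinP; exact: measurable_tuple_prod.
    - by move=> t _; rewrite lee_fin.
    - by rewrite lee_fin.
  rewrite ge0_integralZl ?gc//; first by rewrite -EFinM -exprSr.
  - exact/measurable_EFinP.
  - by move=> y _; rewrite lee_fin.
  - have c0 : (0 <= c)%R by rewrite -lee_fin -gc integral_ge0// => y _; rewrite lee_fin.
    by rewrite lee_fin exprn_ge0.
by apply/measurable_EFinP; exact: measurable_tuple_prod.
Qed.

Variables (M M' : probability Y R) (w : Y -> R).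
Hypotheses (mw : measurable_fun setT w) (w0 : forall y, (0 <= w y)%R).
Hypothesis MM' : forall g, measurable_fun setT g -> (forall y, 0 <= g y) ->
  \int[M']_y g y = \int[M]_y ((w y)%:E * g y).

Let W n (t : n.-tuple Y) : R := (\prod_(y <- t) w y)%R.

Let W0 n (t : n.-tuple Y) : (0 <= W t)%R. Proof. exact: prodr_ge0. Qed.

Lemma ge0_integral_tprob_density n (f : n.-tuple Y -> \bar R) :
  measurable_fun setT f -> (forall t, 0 <= f t) ->
  \int[tprob M' n]_t f t = \int[tprob M n]_t ((W t)%:E * f t).
Proof.
elim: n f => [|n ih] f mf f0; first by rewrite !integral_tprob0 /W big_nil mul1e.
have mWf m (h : m.-tuple Y -> \bar R) : measurable_fun setT h ->
    measurable_fun setT (fun t => (W t)%:E * h t).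
  move=> mh; apply: emeasurable_funM => //.
  by apply/measurable_EFinP; exact: measurable_tuple_prod.
rewrite !ge0_integral_tprobS//; first last.
- by move=> t; rewrite mule_ge0// lee_fin.
- exact: mWf.
rewrite MM'.
- apply: eq_integral => y _; rewrite ih//; last exact: measurable_comp_tcons.
  rewrite -ge0_integralZl//.
  + by apply: eq_integral => t _; rewrite muleA -EFinM /W big_cons.
  + by apply: mWf; exact: measurable_comp_tcons.
  + by move=> t _; rewrite mule_ge0// lee_fin.
  + by rewrite lee_fin.
- apply: (measurable_fun_fubini_tonelli_F (f \o @tcons d Y n)) => //.
    exact: measurableT_comp.
  by move=> t; exact: f0.
- by move=> y; apply: integral_ge0.
Qed.

Lemma integral_tprob_density n (f : n.-tuple Y -> \bar R) :
  (tprob M' n).-integrable setT f ->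
  (tprob M n).-integrable setT (fun t => (W t)%:E * f t) /\
  \int[tprob M n]_t ((W t)%:E * f t) = \int[tprob M' n]_t f t.
Proof.
move=> fi; have mf := measurable_int _ fi.
split.
  apply/integrableP; split.
    apply: emeasurable_funM => //.
    by apply/measurable_EFinP; exact: measurable_tuple_prod.
  under eq_integral do rewrite abseM (gee0_abs (x := (W _)%:E)) ?lee_fin//.
  rewrite -ge0_integral_tprob_density//; last exact: measurableT_comp.
  by case/integrableP: fi.
rewrite integralE [RHS]integralE; congr (_ - _).
  rewrite ge0_integral_tprob_density//; last exact: measurable_funepos.
  apply: eq_integral => t _.
  (* At a fixed t the weight [W t] is a constant, so the scaling rule for positive parts is used on
     constant functions over [unit]. *)
  have := congr1 (fun h => h tt) (@ge0_funeposM unit R (W t) (fun=> f t) (W0 t)).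
  by rewrite !funeposE.
rewrite ge0_integral_tprob_density//; last exact: measurable_funeneg.
apply: eq_integral => t _.
have := congr1 (fun h => h tt) (@ge0_funenegM unit R (W t) (fun=> f t) (W0 t)).
by rewrite !funenegE.
Qed.

End tuple_density.

Section has_mean.
Local Open Scope classical_set_scope.
Context {R : realType} {d} {T : measurableType d} (mu : probability T R).
Implicit Types (f g : T -> R) (r s : R).

(** Integrability is bundled with a real value of the mean, so that linear combinations compose
    without side conditions. *)
Definition has_mean f r :=
  mu.-integrable setT (EFin \o f) /\ (\int[mu]_x (f x)%:E = r%:E)%E.

Lemma has_mean_cst r : has_mean (fun=> r) r.
Proof.
split; first exact: finite_measure_integrable_cst.
have := @integral_cst _ _ _ mu setT measurableT r%:E.
by rewrite [X in (_ * X)%E](probability_setT mu) mule1.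
Qed.

Lemma has_meanD f g r s :
  has_mean f r -> has_mean g s -> has_mean (fun x => f x + g x) (r + s).
Proof.
move=> [fi fr] [gi gs]; split; first exact: (integrableD _ fi gi).
by rewrite EFinD -fr -gs -integralD.
Qed.

Lemma has_meanZ c f r : has_mean f r -> has_mean (fun x => c * f x) (c * r).
Proof.
move=> [fi fr]; split; first exact: (integrableZl _ c fi).
by rewrite EFinM -fr -integralZl.
Qed.

Lemma has_mean_sum (I : finType) (f : I -> T -> R) (r : I -> R) :
  (forall i, has_mean (f i) (r i)) ->
  has_mean (fun x => \sum_i f i x) (\sum_i r i).
Proof.
move=> fr; split.
  rewrite (_ : _ \o _ = fun x => \sum_i (f i x)%:E)%E; last first.
    by apply/funext => x; rewrite /= sumEFin.
  by apply: integrable_sum => // i _; case: (fr i).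
under eq_integral do rewrite -sumEFin.
rewrite integral_sum => [| // | i]; last by case: (fr i).
by rewrite -sumEFin; apply: eq_bigr => i _; case: (fr i).
Qed.

(** The function g may have infinite integral, as a squared error can; the comparison runs through
    the positive part of f. *)
Lemma has_mean_le f (g : T -> \bar R) r :
  has_mean f r -> measurable_fun setT g ->
  (forall x, (f x)%:E <= g x)%E -> (forall x, 0 <= g x)%E ->
  (r%:E <= \int[mu]_x g x)%E.
Proof.
move=> [fi <-] mg fg g0; have mf := measurable_int _ fi.
rewrite integralE (@le_trans _ _ (\int[mu]_x ((EFin \o f)^\+ x))%E)//.
  by rewrite leeBlDr ?leeDl ?integral_ge0// integrable_fin_num// integrable_funeneg.
apply: ge0_le_integral => //; first exact: measurable_funepos.
by move=> x _; rewrite funeposE ge_max fg g0.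
Qed.

End has_mean.

(** The left side is the sum of h (1 + h)^i over i < n. This estimate replaces differentiation in
    the limit t -> 0. *)
Lemma exprD1_sub1_le (R : realFieldType) (n : nat) (h : R) : 0 <= h ->
  (1 + h) ^+ n - 1 <= n%:R * h * (1 + h) ^+ n.
Proof.
move=> h0; have p0 m : 0 <= (1 + h) ^+ m by rewrite exprn_ge0// addr_ge0.
elim: n => [|n ih]; first by rewrite expr0 subrr mul0r mul0r.
rewrite exprSr -natr1; have := p0 n; move: ih.
move: ((1 + h) ^+ n) (n%:R : R) (ler0n R n) => a m m0 ih a0.
have : 0 <= m * h * a * h by rewrite !mulr_ge0.
have : 0 <= h * a * h by rewrite !mulr_ge0.
nra.
Qed.

Section chapman_robbins.
Local Open Scope classical_set_scope.
Context {R : realType} {v n : nat} {d} {Y : measurableType d}.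
Variables (eps : R) (Q : 'I_v -> probability Y R) (est : n.-tuple Y -> 'I_v -> R).
Hypotheses (v0 : (0 < v)%N) (eps0 : 0 < eps).
Hypothesis estU : unbiased Q est.
Variable q : 'I_v -> Y -> R.
Hypothesis mq : forall x, measurable_fun setT (q x).
Hypothesis qle : forall x x' y, q x y <= expR eps * q x' y.
Hypothesis qsum : forall y, \sum_x q x y = v%:R.

Let u := @umix R v d Y Q v0.
Let T := tprob u n.

Hypothesis qE : forall x (g : Y -> \bar R),
  measurable_fun setT g -> (forall y, 0 <= g y)%E ->
  (\int[Q x]_y g y = \int[u]_y ((q x y)%:E * g y))%E.

Let vR : 0 < v%:R :> R. Proof. by rewrite ltr0n. Qed.

(** Privacy at x' = x gives (e^eps - 1) q x y >= 0. *)
Let q0 x y : 0 <= q x y.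
Proof.
have e1 : 0 < expR eps - 1 by rewrite subr_gt0 expR_gt1.
by rewrite -(pmulr_rge0 _ e1) mulrBl mul1r subr_ge0.
Qed.

Let qv x y : q x y <= v%:R.
Proof. by rewrite -(qsum y) (bigD1 x)//= lerDl sumr_ge0. Qed.

Let mean1_q x : has_mean u (q x) 1.
Proof.
split.
  apply: measurable_bounded_integrable => //.
    by rewrite [X in (X < _)%E](probability_setT u) ltry.
  exists v%:R; split; first by rewrite num_real.
  by move=> M vM y _; rewrite /= ger0_norm// (le_trans (qv x y))// ltW.
have := @qE x (cst 1%E) (measurable_cst _) (fun=> lee01).
rewrite integral_cst// mul1e [X in X = _](probability_setT (Q x)) => ->.
by apply: eq_integral => y _; rewrite mule1.
Qed.

Lemma ge0_integral_mixture_density P (PS : prob_simplex v P) (g : Y -> \bar R) :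
  measurable_fun setT g -> (forall y, 0 <= g y)%E ->
  (\int[mixture Q PS]_y g y =
   \int[u]_y ((\sum_x P x * q x y)%:E * g y))%E.
Proof.
move=> mg g0; rewrite ge0_integral_mixture//.
have mqg x : measurable_fun setT (fun y => (q x y)%:E * g y)%E.
  by apply: emeasurable_funM => //; exact/measurable_EFinP.
have qg0 x y : (0 <= (q x y)%:E * g y)%E by rewrite mule_ge0// lee_fin.
have P0 x : 0 <= P x by case: PS.
transitivity (\int[u]_y \sum_x ((P x)%:E * ((q x y)%:E * g y)))%E.
  rewrite ge0_integral_sum//; first last.
  - by move=> x y _; rewrite mule_ge0// lee_fin.
  - by move=> x; exact: measurable_funeM.
  apply: eq_bigr => x _; rewrite qE// ge0_integralZl//; last by rewrite lee_fin.
apply: eq_integral => y _; rewrite -sumEFin ge0_sume_distrl; last first.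
  by move=> x _; rewrite lee_fin mulr_ge0.
by apply: eq_bigr => x _; rewrite muleA EFinM.
Qed.

Lemma est_integrable P (PS : prob_simplex v P) x :
  (tprob (mixture Q PS) n).-integrable setT (fun t => (est t x)%:E).
Proof.
have [mest /(_ P PS x)[fin _]] := estU.
have m1 : measurable_fun setT (fun t => (est t x)%:E) by exact/measurable_EFinP.
apply/integrableP; split => //.
rewrite -(ge0_expectE Q PS)//; exact: measurableT_comp.
Qed.

Lemma integral_est P (PS : prob_simplex v P) x :
  (\int[tprob (mixture Q PS) n]_t (est t x)%:E = (P x)%:E)%E.
Proof.
by rewrite -(expectE (est_integrable PS x)); case: estU => _ /(_ P PS x)[].
Qed.

(** Unbiasedness at every P is transported to the single law [T], with W the n-sample likelihood
    ratio. *)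
Lemma mixture_density_estimate P (PS : prob_simplex v P) x :
  let W t := \prod_(y <- t) \sum_x P x * q x y in
  has_mean T W 1 /\ has_mean T (fun t => W t * est t x) (P x).
Proof.
move=> W.
have mw : measurable_fun setT (fun y => \sum_x P x * q x y).
  by apply: measurable_sum => z; apply: measurable_funM.
have w0 y : 0 <= \sum_x P x * q x y.
  by apply: sumr_ge0 => z _; rewrite mulr_ge0//; case: PS.
have mm := ge0_integral_mixture_density PS.
split.
  have := @has_mean_cst _ _ _ (tprob (mixture Q PS) n) 1.
  move=> [ii ie]; have [] := integral_tprob_density mw w0 mm ii.
  rewrite ie => h1 h2; split.
    by apply: eq_integrable h1 => // t _; rewrite mule1.
  by rewrite -h2; apply: eq_integral => t _; rewrite mule1.
have [] := integral_tprob_density mw w0 mm (est_integrable PS x).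
by rewrite integral_est.
Qed.

(** The chi-square divergence of [Q x] from the uniform mixture. *)
Definition chi2 x : R := fine (\int[u]_y ((q x y - 1) ^+ 2)%:E)%E.

Let mean_chi2 x : has_mean u (fun y => (q x y - 1) ^+ 2) (chi2 x).
Proof.
have ii : u.-integrable setT (EFin \o (fun y => (q x y - 1) ^+ 2)).
  apply: measurable_bounded_integrable => //.
  - by rewrite [X in (X < _)%E](probability_setT u) ltry.
  - by apply: measurable_funX; apply: measurable_funB.
  exists ((v%:R + 1) ^+ 2); split; first by rewrite num_real.
  move=> M vM y _; rewrite /= ger0_norm ?sqr_ge0// (le_trans _ (ltW vM))//.
  by have := q0 x y; have := qv x y; have := vR; nra.
by split => //; rewrite fineK// integrable_fin_num.
Qed.

Lemma chi2_ge0 x : 0 <= chi2 x.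
Proof. by apply: fine_ge0; apply: integral_ge0 => y _; rewrite lee_fin sqr_ge0. Qed.

Lemma sum_chi2_le S : (forall y, \sum_x (q x y - 1) ^+ 2 <= S) ->
  \sum_x chi2 x <= S.
Proof.
move=> qS; rewrite -lee_fin.
have [_ <-] := @has_mean_cst _ _ _ u S.
apply: has_mean_le (has_mean_sum mean_chi2) _ _ _ => //.
move=> y; rewrite lee_fin (le_trans _ (qS y))// sumr_ge0// => x _.
exact: sqr_ge0.
Qed.

Let tilt x (t : R) : 'I_v -> R := fun z => (1 - t) / v%:R + t * (z == x)%:R.

Let tilt_simplex x t : 0 <= t <= 1 -> prob_simplex v (tilt x t).
Proof.
move=> /andP[t0 t1]; split => [z|].
  by rewrite addr_ge0 ?mulr_ge0 ?invr_ge0 ?subr_ge0 ?ler0n.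
rewrite big_split/= sumr_const card_ord -[_ *+ v]mulr_natr divfK ?gt_eqF//.
rewrite -mulr_sumr (bigD1 x)//= eqxx big1 => [|z /negPf ->//].
by rewrite addr0 mulr1 subrK.
Qed.

Let tilt_density x t y : \sum_z tilt x t z * q z y = 1 + t * (q x y - 1).
Proof.
transitivity (\sum_z ((1 - t) / v%:R * q z y + t * ((z == x)%:R * q z y))).
  by apply: eq_bigr => z _; rewrite mulrDl mulrA.
rewrite big_split/= -mulr_sumr qsum divfK ?gt_eqF// -mulr_sumr (bigD1 x)//=.
rewrite eqxx big1 => [|z /negPf ->]; last by rewrite mul0r.
by rewrite mul1r; ring.
Qed.

(** Coordinate x is tested against the tilt towards x, with a common multiplier c that [cramer_rao]
    optimises. Completing a square instead of using Cauchy-Schwarz avoids assuming that [est] is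
    square integrable. *)
Lemma chapman_robbins (c t : R) : 0 <= t <= 1 ->
  ((2 * c * t * (v%:R - 1) - c ^+ 2 * \sum_x ((1 + t ^+ 2 * chi2 x) ^+ n - 1))%:E
    <= expect (fun=> v%:R^-1)%R Q (fun s => (l2sq (fun=> v%:R^-1)%R (est s))%:E))%E.
Proof.
move=> t01; have [mest _] := estU.
pose W x (s : n.-tuple Y) := \prod_(y <- s) (1 + t * (q x y - 1)).
have WE x s : W x s = \prod_(y <- s) \sum_z tilt x t z * q z y.
  by apply: eq_bigr => y _; rewrite tilt_density.
have W1 x : has_mean T (W x) 1.
  have [+ _] := mixture_density_estimate (tilt_simplex x t01) x.
  by under [X in has_mean _ X]funext do rewrite -WE.
have We x : has_mean T (fun s => W x s * est s x) ((1 - t) / v%:R + t).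
  have [_] := mixture_density_estimate (tilt_simplex x t01) x.
  under [X in has_mean _ X]funext do rewrite -WE.
  by rewrite /tilt eqxx mulr1.
have e1 x : has_mean T (fun s => est s x) v%:R^-1.
  split; first exact: (est_integrable (uniform_simplex v0)).
  exact: (integral_est (uniform_simplex v0)).
have W2 x : has_mean T (fun s => W x s ^+ 2) ((1 + t ^+ 2 * chi2 x) ^+ n).
  have mg : measurable_fun setT (fun y => (1 + t * (q x y - 1)) ^+ 2).
    apply: measurable_funX; apply: measurable_funD => //.
    by apply: measurable_funM => //; apply: measurable_funB.
  (* The term linear in q - 1 integrates to zero because q x has mean 1. *)
  have gE : (\int[u]_y ((1 + t * (q x y - 1)) ^+ 2)%:E = (1 + t ^+ 2 * chi2 x)%:E)%E.
    have [_ <-] : has_mean u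
        (fun y => (1 - 2 * t) + ((2 * t) * q x y + t ^+ 2 * (q x y - 1) ^+ 2))
        (1 + t ^+ 2 * chi2 x).
      have -> : 1 + t ^+ 2 * chi2 x =
          (1 - 2 * t) + (2 * t * 1 + t ^+ 2 * chi2 x) by ring.
      apply: has_meanD; first exact: has_mean_cst.
      by apply: has_meanD; apply: has_meanZ.
    by apply: eq_integral => y _; congr EFin; ring.
  have WsE s : W x s ^+ 2 = \prod_(y <- s) (1 + t * (q x y - 1)) ^+ 2.
    by rewrite /W prodrXl.
  have WI : (\int[T]_s (W x s ^+ 2)%:E = ((1 + t ^+ 2 * chi2 x) ^+ n)%:E)%E.
    under eq_integral do rewrite WsE.
    by apply: ge0_integral_tprob_prod => // y; exact: sqr_ge0.
  split => //; apply/integrableP; split.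
    apply/measurable_EFinP; under eq_fun do rewrite WsE.
    exact: measurable_tuple_prod.
  under eq_integral do rewrite /= ger0_norm ?sqr_ge0//.
  by rewrite WI ltry.
have ml2 : measurable_fun setT (fun s => (l2sq (fun=> v%:R^-1)%R (est s))%:E).
  apply/measurable_EFinP; apply: measurable_sum => x.
  by apply: measurable_funX; apply: measurable_funB.
have l20 s : (0 <= (l2sq (fun=> v%:R^-1)%R (est s))%:E)%E.
  by rewrite lee_fin sumr_ge0// => x _; exact: sqr_ge0.
rewrite (ge0_expectE Q (uniform_simplex v0))//.
(* The squared error at x minus the completed square: the square of [est s x] cancels, and only
   terms with known means remain. *)
have hx x : has_mean T
    (fun s => 2 * c * (W x s * est s x)
      + (- (2 * c) * est s x
      + ((2 * c ^+ 2 - 2 * c / v%:R) * W x s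
      + (- c ^+ 2 * W x s ^+ 2 + (2 * c / v%:R - c ^+ 2)))))
    (2 * c * t * (1 - v%:R^-1) - c ^+ 2 * ((1 + t ^+ 2 * chi2 x) ^+ n - 1)).
  have -> : 2 * c * t * (1 - v%:R^-1) - c ^+ 2 * ((1 + t ^+ 2 * chi2 x) ^+ n - 1)
    = 2 * c * ((1 - t) / v%:R + t)
      + (- (2 * c) * v%:R^-1
      + ((2 * c ^+ 2 - 2 * c / v%:R) * 1
      + (- c ^+ 2 * (1 + t ^+ 2 * chi2 x) ^+ n + (2 * c / v%:R - c ^+ 2)))).
    by ring.
  apply: has_meanD; first exact: has_meanZ.
  apply: has_meanD; first exact: has_meanZ.
  apply: has_meanD; first exact: has_meanZ.
  by apply: has_meanD; [exact: has_meanZ|exact: has_mean_cst].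
have -> : 2 * c * t * (v%:R - 1) - c ^+ 2 * \sum_x ((1 + t ^+ 2 * chi2 x) ^+ n - 1)
  = \sum_x (2 * c * t * (1 - v%:R^-1) - c ^+ 2 * ((1 + t ^+ 2 * chi2 x) ^+ n - 1)).
  rewrite [RHS]sumrB -mulr_sumr; congr (_ - _); last by rewrite mulr_sumr.
  by rewrite sumr_const card_ord -mulr_natr; field; rewrite gt_eqF.
(* The integrand is a completed square: 0 <= (1/v - est_x + c (W_x - 1))^2. *)
apply: has_mean_le (has_mean_sum hx) ml2 _ l20 => s.
rewrite lee_fin; apply: ler_sum => x _; rewrite -subr_ge0.
rewrite (_ : _ - _ = (v%:R^-1 - est s x + c * (W x s - 1)) ^+ 2); last by ring.
exact: sqr_ge0.
Qed.

Lemma cramer_rao S : (1 <= n)%N -> 0 < S ->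
  (forall y, \sum_x (q x y - 1) ^+ 2 <= S) ->
  (((v%:R - 1) ^+ 2 / (n%:R * S))%:E <= risk Q est)%E.
Proof.
move=> n1 S0 /sum_chi2_le chiS.
apply: (@le_trans _ _
  (expect (fun=> v%:R^-1)%R Q (fun s => (l2sq (fun=> v%:R^-1)%R (est s))%:E))); last first.
  by apply: ereal_sup_ubound; exists (fun=> v%:R^-1)%R => //; exact: uniform_simplex.
have := chapman_robbins; case: (expect _ _ _) => [r| |]; first last.
(* The value -oo is excluded by the bound at c = t = 0, whose left side is finite. *)
- by move=> /(_ 0 0); rewrite lexx ler01 => /(_ isT).
- by rewrite leey.
move=> rge; rewrite lee_fin leNgt; apply/negP.
set K := _ / _ => rK.
have nR : 0 < n%:R :> R by rewrite ltr0n.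
have chiSx x : chi2 x <= S.
  by apply: le_trans chiS; rewrite (bigD1 x)//= lerDl sumr_ge0// => z _; exact: chi2_ge0.
have r0 : 0 <= r.
  have := rge 0 0; rewrite lexx ler01 => /(_ isT); rewrite lee_fin.
  by rewrite mulr0 !mul0r expr0n/= mul0r subr0.
(* A bound on K whose error is of order t for fixed n, S and r; a small t will contradict r < K. *)
have rt t : 0 < t <= 1 -> K <= r * (1 + n%:R * (t * S) * (1 + S) ^+ n).
  move=> /andP[t0 t1].
  pose h := t ^+ 2 * S.
  have h0 : 0 <= h by rewrite mulr_ge0 ?sqr_ge0// ltW.
  have tt : t ^+ 2 <= t by rewrite expr2 ler_piMl// ltW.
  have hS : h <= S by rewrite ler_piMl ?(ltW S0)// (le_trans tt).
  pose D := (1 + h) ^+ n.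
  have D0 : 0 < D by rewrite exprn_gt0// ltr_pwDl.
  have sumle : \sum_x ((1 + t ^+ 2 * chi2 x) ^+ n - 1) <= n%:R * h * D.
    apply: (@le_trans _ _ (\sum_x n%:R * (t ^+ 2 * chi2 x) * D)).
      apply: ler_sum => x _.
      have hx0 : 0 <= t ^+ 2 * chi2 x by rewrite mulr_ge0 ?sqr_ge0 ?chi2_ge0.
      apply: (le_trans (exprD1_sub1_le n hx0)).
      apply: ler_wpM2l; first by rewrite mulr_ge0 ?ler0n.
      by apply: lerXn2r; rewrite ?nnegrE ?addr_ge0// lerD2l ler_wpM2l ?sqr_ge0.
    rewrite -mulr_suml ler_wpM2r ?(ltW D0)// -mulr_sumr ler_wpM2l ?ler0n//.
    by rewrite -mulr_sumr ler_wpM2l ?sqr_ge0.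
  have KD : K <= r * D.
    (* The maximiser of 2 c t (v - 1) - c^2 n t^2 S D; the maximum is K / D. *)
    pose c := (v%:R - 1) / (n%:R * S * D) / t.
    have := rge c t; rewrite (ltW t0) t1 => /(_ isT); rewrite lee_fin.
    have -> : 2 * c * t * (v%:R - 1) = 2 * K / D.
      by rewrite /c /K; field; rewrite !gt_eqF.
    move=> le1; rewrite -ler_pdivrMr//.
    apply: le_trans le1; rewrite -subr_ge0.
    have : c ^+ 2 * \sum_x ((1 + t ^+ 2 * chi2 x) ^+ n - 1) <= K / D.
      apply: (le_trans (ler_wpM2l (sqr_ge0 c) sumle)).
      rewrite le_eqVlt; apply/orP; left; apply/eqP.
      by rewrite /c /K /h; field; rewrite !gt_eqF.
    by lra.
  apply: (le_trans KD); rewrite ler_wpM2l//.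
  rewrite -lerBlDl (le_trans (exprD1_sub1_le n h0))//.
  have S1 : 0 <= 1 + S by rewrite addr_ge0// ltW.
  have htS : h <= t * S by rewrite /h ler_wpM2r// ltW.
  have h1 : 0 <= 1 + h by rewrite addr_ge0.
  clearbody h; apply: ler_pM.
  - by rewrite mulr_ge0 ?ler0n.
  - exact: exprn_ge0.
  - by rewrite ler_wpM2l ?ler0n.
  - by apply: lerXn2r; rewrite ?nnegrE// lerD2l.
pose C := r * (n%:R * S * (1 + S) ^+ n).
have C0 : 0 <= C.
  by rewrite mulr_ge0// mulr_ge0 ?exprn_ge0 ?addr_ge0 ?mulr_ge0// ?ler0n// ltW.
(* Chosen so that C t + t <= K - r, hence C t < K - r; the denominator C + 1 is positive even if C =
   0. *)
pose t := Num.min 1 ((K - r) / (C + 1)).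
have C1 : 0 < C + 1 by rewrite ltr_wpDl.
have t0 : 0 < t by rewrite lt_min ltr01 divr_gt0// subr_gt0.
have t1 : t <= 1 by rewrite ge_min lexx.
have := rt t; rewrite t0 t1 => /(_ isT).
have -> : r * (1 + n%:R * (t * S) * (1 + S) ^+ n) = r + C * t by rewrite /C; ring.
rewrite leNgt => /negP; apply.
rewrite -ltrBrDl.
have : t * (C + 1) <= K - r by rewrite -ler_pdivlMr// ge_min lexx orbT.
by move: t0; move: (K - r) => z; lra.
Qed.

End chapman_robbins.

(** * Matching the upper and lower bounds *)

Theorem theorem4 (R : realType) (v b r k lam n : nat) (eps : R)
  (Q : 'I_v -> probability (bout b) R)
  (est : n.-tuple (bout b) -> 'I_v -> R)
  (d : measure_display) (Y' : measurableType d)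
  (Q' : 'I_v -> probability Y' R)
  (est' : n.-tuple Y' -> 'I_v -> R) :
  (2 <= v)%N -> 0 < eps -> (1 <= n)%N ->
  block_design_scheme v b r k lam eps n Q est ->
  Kopt v eps k ->
  ldp eps Q' -> unbiased Q' est' ->
  (risk Q est <= risk Q' est')%E.
Proof.
move=> v2 eps0 n1 [I [BD Qp ->]] kopt Qldp estU.
apply: (le_trans (bd_risk_le BD eps0 Qp n1)).
have v0 : (0 < v)%N by exact: ltnW.
have [q [mq qle qsum qE]] := ldp_density v0 eps0 Qldp.
have e0 : 0 < expR eps - 1 by rewrite subr_gt0 expR_gt1.
have vR : 0 < v%:R :> R by rewrite ltr0n.
have obj0 : 0 < kopt_obj v eps k.
  case: kopt => /andP[k0 kv] _; have kR : k%:R < v%:R :> R by rewrite ltr_nat.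
  have k0R : 0 < k%:R :> R by rewrite ltr0n.
  rewrite divr_gt0 ?exprn_gt0 ?mulr_gt0 ?subr_gt0//.
  by rewrite (lt_le_trans kR)// lerDr mulr_ge0 ?expR_ge0// ltW.
have S0 : 0 < (expR eps - 1) ^+ 2 * v%:R / kopt_obj v eps k.
  by rewrite divr_gt0// mulr_gt0// exprn_gt0.
have qS y : \sum_x (q x y - 1) ^+ 2
    <= (expR eps - 1) ^+ 2 * v%:R / kopt_obj v eps k.
  by apply: ldp_vector_bound => // x x'; exact: qle.
apply: le_trans (cramer_rao eps0 estU mq qle qsum qE n1 S0 qS).
(* For this S the lower bound equals the block design bound exactly. *)
rewrite lee_fin le_eqVlt; apply/orP; left; apply/eqP.
by field; rewrite !gt_eqF// ltr0n.
Qed.
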